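(* Let $n\ge 1$ be an integer, let $\langle\cdot,\cdot\rangle_\star$ be a Hermitian form on $\mathbb C^n$ of arbitrary signature (possibly indefinite or degenerate), and let $\tau$ be the multiplicity of its zero eigenvalue. Assume $\langle\cdot,\cdot\rangle_\star$ has at least two non-zero eigenvalues (counted with multiplicity), i.e. $\tau\le n-2$. Write $\|z\|_\star^2:=\langle z,z\rangle_\star$. Let $k_0$ be the largest $k\in\mathbb N$ such that $n\geq k^2+k(3+2\tau)+2+\tau$. Let $A(z,\bar z)\in\mathbb C[z_1,\ldots,z_n,\bar z_1,\ldots,\bar z_n]$ be a non-zero Hermitian polynomial, where $z=(z_1,\ldots,z_n)$, and let $R$ be the rank of $A(z,\bar z)\|z\|_\star^2$. Then either $$R\geq (k_0+1)n-(k_0+1)(k_0+\tau),$$ or there exists $k\in\{1,\ldots,k_0\}$ such that $$kn-k(k-1+\tau)\leq R\leq kn+k(2+\tau).$$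
   Context: $\mathbb N$ denotes the non-negative integers (including $0$); if $k_0=0$ the set $\{1,\ldots,k_0\}$ is empty. A polynomial $P(z,\bar z)\in\mathbb C[z_1,\ldots,z_n,\bar z_1,\ldots,\bar z_n]$ is called Hermitian if it is real valued. Every Hermitian polynomial $P(z,\bar z)$ can be written as $P(z,\bar z)=|P_1^+(z)|^2+\cdots+|P_p^+(z)|^2-|P_1^-(z)|^2-\cdots-|P_q^-(z)|^2$ with $P_1^+,\ldots,P_p^+,P_1^-,\ldots,P_q^-$ linearly independent holomorphic polynomials in $z$; the number $p+q$ is uniquely determined by $P$ and is called the rank of $P$ (equivalently, it is the rank of the Hermitian matrix of coefficients $(c_{\alpha\beta})$ in $P=\sum c_{\alpha\beta}z^\alpha\bar z^\beta$). *)

(* Defs.v *)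
From mathcomp Require Import all_boot all_order all_algebra.
From mathcomp Require Import sesquilinear.
From mathcomp Require Import reals.
From mathcomp Require Import complex.
From mathcomp Require Import mpoly.

Set Implicit Arguments.
Unset Strict Implicit.
Unset Printing Implicit Defensive.

Import Order.TTheory GRing.Theory Num.Theory.
Local Open Scope ring_scope.

Section HermitianPolynomials.
Variables (R : realType) (n : nat).
Local Notation C := R[i].

(* An element P(z, zbar) of C[z_1, ..., z_n, zbar_1, ..., zbar_n] is encoded
   as an element of {mpoly C[n + n]}: the variable lshift n i stands for z_i
   and the variable rshift n i for zbar_i. *)
Definition zvar (i : 'I_n) : {mpoly C[n + n]} := 'X_(lshift n i).
Definition zbarvar (i : 'I_n) : {mpoly C[n + n]} := 'X_(rshift n i).

Definition zzbar (z : 'I_n -> C) (i : 'I_(n + n)) : C :=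
  match split i with inl j => z j | inr j => (z j)^* end.

Definition evalzzbar (P : {mpoly C[n + n]}) (z : 'I_n -> C) : C :=
  P.@[zzbar z].

Definition hermitian_poly (P : {mpoly C[n + n]}) : Prop :=
  forall z : 'I_n -> C, evalzzbar P z \is Num.real.

Definition lin_indep (I : finType) (f : I -> {mpoly C[n]}) : Prop :=
  forall c : I -> C, \sum_i c i *: f i = 0 -> forall i, c i = 0.

(* A relation rather than a function: for Hermitian P such an r exists and is
   unique. *)
Definition hermitian_rank (P : {mpoly C[n + n]}) (r : nat) : Prop :=
  exists (p q : nat) (Pp : 'I_p -> {mpoly C[n]}) (Pm : 'I_q -> {mpoly C[n]}),
  [/\ lin_indep (fun s : 'I_p + 'I_q =>
                   match s with inl i => Pp i | inr j => Pm j end),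
      forall z : 'I_n -> C,
        evalzzbar P z = \sum_(i < p) `|(Pp i).@[z]| ^+ 2
                        - \sum_(j < q) `|(Pm j).@[z]| ^+ 2
    & r = (p + q)%N].

(* <z, z> as a polynomial in z and zbar; the form is linear in its first
   argument and conjugate-linear in the second. *)
Definition sqnorm_poly (h : {hermitian_sym 'rV[C]_n for Num.conj}) :
    {mpoly C[n + n]} :=
  \sum_(i < n) \sum_(j < n) matrix_of_form h i j *: (zvar i * zbarvar j).

(* Eigenvalues of a form on C^n are those of its matrix in the standard basis. *)
Definition nullity (h : {hermitian_sym 'rV[C]_n for Num.conj}) : nat :=
  mup 0 (char_poly (matrix_of_form h)).

End HermitianPolynomials.

Definition is_largest (P : nat -> Prop) (k0 : nat) : Prop :=
  P k0 /\ forall k : nat, P k -> (k <= k0)%N.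

(* Main.v *)
Require Import Defs.
From mathcomp Require Import all_boot all_order all_algebra.
From mathcomp Require Import sesquilinear reals complex mpoly.
From mathcomp Require boolp.
From mathcomp Require Import zify.

(** Polarizing [A ||z||^2 = sum_s e_s |F_s|^2] gives
    [A(z, w) <z, w> = sum_s e_s F_s(z) conj(F_s(w))], so the map
    [F = (F_1, ..., F_R)] takes orthogonal vectors to orthogonal vectors.
    Let [d_a] be the dimension of the linear span of [F(E)] for a generic
    [a]-dimensional subspace [E], and let [nu = n - tau].
    - Since [d_n = R] and a generic [E] has a generic [E'] of dimension
      [nu - dim E] orthogonal to it, [d_a + d_(nu - a) <= R].
    - The increments satisfy [d_a - d_(a-1) >= min(d_J - d_(J-1), a)] for
      [a <= J].
    If [d_J - d_(J-1) > k] for some [J >= nu / 2], then summing the second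
    inequality bounds [d_J + d_(nu - J)] below by [(k+1)(nu - k)]. Hence
    [R < (k+1)(nu - k)] forces all increments above [nu / 2] to be at most [k],
    and a second use of orthogonality yields [R <= k (2n - nu) = k (n + tau)].
    The theorem follows with the least [k] such that [R < (k+1)(nu - k)]. *)

Import Order.TTheory GRing.Theory Num.Theory.
Local Open Scope ring_scope.
Set Implicit Arguments.
Unset Strict Implicit.
Unset Printing Implicit Defensive.

(** * Ranks, minors and spans over a field *)

Section LinearAlgebra.
Variable K : fieldType.

Lemma rank_factor m n a (P : 'M[K]_(m, n)) : (\rank P <= a)%N ->
  exists (c : 'M_(m, a)) (u : 'M_(a, n)), P = c *m u.
Proof.
move=> le_Pa; exists (col_ebase P *m pid_mx (\rank P)).
exists (pid_mx (\rank P) *m row_ebase P).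
by rewrite mulmxA -(mulmxA (col_ebase P)) pid_mx_id // mulmx_ebase.
Qed.

(** Together with [minor_rank], this turns a lower bound on the rank into the nonvanishing of one
    determinant, an open condition along a path. *)
Lemma rank_minor m n a (P : 'M[K]_(m, n)) : (a <= \rank P)%N ->
  exists (c : 'M_(a, m)) (d : 'M_(n, a)), c *m P *m d = 1%:M.
Proof.
move=> le_aP; exists (pid_mx a *m invmx (col_ebase P)).
exists (invmx (row_ebase P) *m pid_mx a).
rewrite -{2}(mulmx_ebase P) !mulmxA mulmxKV ?col_ebase_unit //.
rewrite mulmxK ?row_ebase_unit // -[in LHS]mulmxA !mul_pid_mx.
by rewrite (minn_idPr le_aP) (minn_idPr (leq_trans le_aP (rank_leq_col P))) minnn
           (minn_idPr (leq_trans le_aP (rank_leq_row P))) pid_mx_1.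
Qed.

Lemma minor_rank m n a (P : 'M[K]_(m, n)) (c : 'M_(a, m)) (d : 'M_(n, a)) :
  \det (c *m P *m d) != 0 -> (a <= \rank P)%N.
Proof.
move=> det_n0; have /mxrank_unit <- : c *m P *m d \in unitmx.
  by rewrite unitmxE unitfE.
by rewrite (leq_trans (mxrankM_maxl _ _)) ?mxrankM_maxr.
Qed.

Lemma rank_row_selection m n a (P : 'M[K]_(m, n)) : (a <= \rank P)%N ->
  exists f : 'I_a -> 'I_m, row_free (rowsub f P).
Proof.
move=> le_aP; exists (maxrankfun P \o widen_ord le_aP).
rewrite rowsub_comp rowsubE /row_free mxrankMfree ?maxrowsub_free //.
have <-: (pid_mx a : 'M[K]_(a, \rank P)) = rowsub (widen_ord le_aP) 1%:M.
  by apply/matrixP=> i j; rewrite !mxE -val_eqE /= ltn_ord andbT.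
by rewrite rank_pid_mx.
Qed.

(** The rows of [A] lie in the part of the joint row space killed by [x], so rank-nullity for [x]
    adds their rank to that of the image. *)
Lemma rank_col_mx_ann m1 m2 n p (A : 'M[K]_(m1, n)) (B : 'M_(m2, n))
    (x : 'M_(n, p)) : A *m x = 0 ->
  (\rank A + \rank (B *m x) <= \rank (col_mx A B))%N.
Proof.
move=> Ax0; rewrite -(mxrank_mul_ker (col_mx A B) x) addnC leq_add //.
  by apply: mxrankS; rewrite mul_col_mx -addsmxE addsmxSr.
apply: mxrankS; rewrite sub_capmx -addsmxE addsmxSl /=.
by apply/sub_kermxP.
Qed.

(** Otherwise points could be added forever, each raising the rank, which is at most [r]. *)
Lemma span_saturation T r (f : T -> 'rV[K]_r) :
  exists (m : nat) (p : 'I_m -> T), forall x, (f x <= \matrix_i f (p i))%MS.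
Proof.
apply: boolp.contrapT => nosat.
suff /(_ r.+1) [m [p]] : forall k, exists (m : nat) (p : 'I_m -> T),
    (k <= \rank (\matrix_i f (p i)))%N.
  by rewrite leqNgt ltnS rank_leq_col.
elim=> [|k [m [p le_k]]]; first by exists 0%N, (ffun0 (card_ord 0)).
have [x nfx] : exists x, ~ (f x <= \matrix_i f (p i))%MS.
  by apply/boolp.existsNP => sat; apply: nosat; exists m, p.
exists m.+1, (fun i => oapp p x (unlift ord0 i)).
apply: (leq_ltn_trans le_k); apply: rank_ltmx; rewrite ltmxE; apply/andP; split.
  apply/row_subP => i; rewrite rowK; apply: (eq_row_sub (lift ord0 i)).
  by rewrite rowK liftK.
apply/negP => /row_subP /(_ ord0); by rewrite rowK unlift_none.
Qed.

End LinearAlgebra.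

(** * Generic rank along polynomial paths of matrices *)

Section PolynomialPaths.
Variable K : numFieldType.

Lemma poly_vanish (q : {poly K}) : (forall k : nat, q.[k%:R] = 0) -> q = 0.
Proof.
move=> q0; apply/eqP; apply: contraT => q_n0.
have : (size [seq k%:R : K | k <- iota 0 (size q)] < size q)%N.
  apply: max_poly_roots => //; last first.
    by rewrite map_inj_uniq ?iota_uniq //; exact: mulrIn (oner_neq0 _).
  by apply/allP => _ /mapP [k _ ->]; apply/rootP.
by rewrite size_map size_iota ltnn.
Qed.

Lemma poly_nonroot (q : {poly K}) : q != 0 -> exists t, q.[t] != 0.
Proof.
move=> q_n0; apply: boolp.contrapT => allroot; move/eqP: q_n0; apply.
by apply: poly_vanish => k; apply/eqP; apply: boolp.contrapT => /negP ?; apply: allroot; exists k%:R.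
Qed.

Lemma horner_mmap n (h : 'I_n -> {poly K}) (p : {mpoly K[n]}) t :
  (mmap polyC h p).[t] = p.@[fun i => (h i).[t]].
Proof.
rewrite /mmap mevalE -horner_evalE raddf_sum; apply: eq_bigr => m _.
rewrite /= horner_evalE hornerM hornerC; congr (_ * _).
by rewrite -horner_evalE rmorph_prod; apply: eq_bigr => j _; rewrite rmorphXn.
Qed.

Definition mxeval m n (t : K) : 'M[{poly K}]_(m, n) -> 'M[K]_(m, n) :=
  map_mx (horner_eval t).

Lemma mxevalC m n t (A : 'M[K]_(m, n)) : mxeval t (map_mx polyC A) = A.
Proof. by apply/matrixP=> i j; rewrite !mxE horner_evalE hornerC. Qed.

Lemma mxevalM m n p t (A : 'M_(m, n)) (B : 'M_(n, p)) :
  mxeval t (A *m B) = mxeval t A *m mxeval t B.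
Proof. exact: map_mxM. Qed.

Lemma mxevalD m n t (A B : 'M_(m, n)) :
  mxeval t (A + B) = mxeval t A + mxeval t B.
Proof. exact: map_mxD. Qed.

Lemma mxeval_col_mx m1 m2 n t (A : 'M_(m1, n)) (B : 'M_(m2, n)) :
  mxeval t (col_mx A B) = col_mx (mxeval t A) (mxeval t B).
Proof. exact: map_col_mx. Qed.

(** A compressed determinant equal to 1 at [t0] is a polynomial in [t]; away from its roots the rank
    cannot drop below its value at [t0]. *)
Lemma rank_mxeval_generic m n (A : 'M[{poly K}]_(m, n)) t0 :
  exists2 q : {poly K}, q != 0 &
    forall t, q.[t] != 0 -> (\rank (mxeval t0 A) <= \rank (mxeval t A))%N.
Proof.
have [c [d cAd]] := rank_minor (leqnn (\rank (mxeval t0 A))).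
pose q := \det (map_mx polyC c *m A *m map_mx polyC d).
have qE t : q.[t] = \det (c *m mxeval t A *m d).
  by rewrite -horner_evalE -det_map_mx -/(mxeval t _) !mxevalM !mxevalC.
exists q => [|t]; last by rewrite qE; exact: minor_rank.
by apply: contra_eq_neq (qE t0) => ->; rewrite horner0 cAd det1 eq_sym oner_eq0.
Qed.

Lemma common_generic (P Q : K -> Prop) (p q : {poly K}) :
  p != 0 -> q != 0 -> (forall t, p.[t] != 0 -> P t) ->
  (forall t, q.[t] != 0 -> Q t) -> exists t, P t /\ Q t.
Proof.
move=> p0 q0 Pp Qq; have [t] := poly_nonroot (mulf_neq0 p0 q0).
by rewrite hornerM mulf_eq0 negb_or => /andP[pt qt]; exists t; split; auto.
Qed.

Lemma rank_mxeval_common m1 n1 m2 n2 (A : 'M_(m1, n1)) (B : 'M_(m2, n2)) t1 t2 :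
  exists t, (\rank (mxeval t1 A) <= \rank (mxeval t A))%N /\
            (\rank (mxeval t2 B) <= \rank (mxeval t B))%N.
Proof.
have [p p0 pP] := rank_mxeval_generic A t1.
have [q q0 qP] := rank_mxeval_generic B t2.
exact: common_generic p0 q0 pP qP.
Qed.

Definition mxpath m n (A B : 'M[K]_(m, n)) : 'M[{poly K}]_(m, n) :=
  map_mx polyC A + 'X *: map_mx polyC (B - A).

Lemma mxpathE m n (A B : 'M_(m, n)) t : mxeval t (mxpath A B) = A + t *: (B - A).
Proof.
by apply/matrixP=> i j; rewrite !mxE horner_evalE !hornerE.
Qed.

Lemma mxpath0 m n (A B : 'M_(m, n)) : mxeval 0 (mxpath A B) = A.
Proof. by rewrite mxpathE scale0r addr0. Qed.

Lemma mxpath1 m n (A B : 'M_(m, n)) : mxeval 1 (mxpath A B) = B.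
Proof. by rewrite mxpathE scale1r addrC subrK. Qed.

End PolynomialPaths.

(** * Spans of the values of a polynomial map on subspaces *)

Section EvaluationMatrices.
Variables (K : numFieldType) (n r : nat) (F : 'I_r -> {mpoly K[n]}).

Definition evalmx m (P : 'M[K]_(m, n)) : 'M[K]_(m, r) :=
  \matrix_(i, s) (F s).@[P i].

Definition evalmx_poly m (P : 'M[{poly K}]_(m, n)) : 'M[{poly K}]_(m, r) :=
  \matrix_(i, s) mmap polyC (P i) (F s).

Lemma mxeval_evalmx m (P : 'M[{poly K}]_(m, n)) t :
  mxeval t (evalmx_poly P) = evalmx (mxeval t P).
Proof.
apply/matrixP=> i s; rewrite !mxE horner_evalE horner_mmap.
by apply: meval_eq => j; rewrite mxE.
Qed.

Lemma evalmx_col_mx m1 m2 (P : 'M_(m1, n)) (Q : 'M_(m2, n)) :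
  evalmx (col_mx P Q) = col_mx (evalmx P) (evalmx Q).
Proof.
apply/matrixP=> i s; rewrite !mxE; case: splitP => j def_i; rewrite !mxE;
  apply: meval_eq => k; first by rewrite (_ : i = lshift _ j) ?col_mxEu //; apply: val_inj.
by rewrite (_ : i = rshift _ j) ?col_mxEd //; apply: val_inj.
Qed.

Lemma evalmx_rowsub m1 m2 (f : 'I_m2 -> 'I_m1) (P : 'M_(m1, n)) :
  evalmx (rowsub f P) = rowsub f (evalmx P).
Proof. by apply/matrixP=> i s; rewrite !mxE; apply: meval_eq => k; rewrite mxE. Qed.

Lemma evalmx_row m (P : 'M_(m, n)) i : evalmx (row i P) = row i (evalmx P).
Proof. by rewrite !rowEsub evalmx_rowsub. Qed.

(* The dimension of the span of F(E), maximized over subspaces E of dimension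
   at most a; the maximum is the generic value. *)
Definition gdim (a : nat) : nat :=
  \max_(k < r.+1 | boolp.asbool (exists m (P : 'M[K]_(m, n)),
      (\rank P <= a)%N /\ \rank (evalmx P) = k)) k.

Lemma gdim_max a m (P : 'M[K]_(m, n)) :
  (\rank P <= a)%N -> (\rank (evalmx P) <= gdim a)%N.
Proof.
move=> le_Pa; have lt_r : (\rank (evalmx P) < r.+1)%N by rewrite ltnS rank_leq_col.
apply: (@leq_bigmax_cond _ _ _ (Ordinal lt_r)).
by apply/boolp.asboolP; exists m, P.
Qed.

Lemma gdim_attained a : exists m (c : 'M[K]_(m, a)) (u : 'M_(a, n)),
  \rank (evalmx (c *m u)) = gdim a.
Proof.
have nonempty : (0 < #|[pred k : 'I_r.+1 | boolp.asbool (exists m (P : 'M[K]_(m, n)),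
    (\rank P <= a)%N /\ \rank (evalmx P) = k)]|)%N.
  apply/card_gt0P; exists ord0; apply/boolp.asboolP.
  by exists 0%N, 0; rewrite mxrank0 (flatmx0 (evalmx _)) mxrank0.
have [k /boolp.asboolP [m [P [le_Pa rkP]]] kE] := eq_bigmax_cond (fun k => val k) nonempty.
have [c [u def_P]] := rank_factor le_Pa; exists m, c, u.
by rewrite -def_P rkP /gdim kE.
Qed.

Lemma gdim_le a : (gdim a <= r)%N.
Proof. by have [m [c [u <-]]] := gdim_attained a; exact: rank_leq_col. Qed.

Lemma gdim_mono a b : (a <= b)%N -> (gdim a <= gdim b)%N.
Proof.
move=> le_ab; have [m [c [u <-]]] := gdim_attained a.
by rewrite gdim_max // (leq_trans (mxrankM_maxr _ _)) // (leq_trans (rank_leq_row _)).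
Qed.

End EvaluationMatrices.

(** * Growth of the generic dimension *)

Section Growth.
Variables (K : numFieldType) (n r : nat) (F : 'I_r -> {mpoly K[n]}).

(** With [b] fixed, [w] moves from a frame attaining [gdim F J.+1] to one whose first [a] rows
    attain [gdim F a]; a generic time on the path does both. *)
Lemma gdim_flag a J : (a <= J)%N ->
  exists (b : 'rV[K]_n) (w : 'M_(J, n)) m0 (c0 : 'M_(m0, 1 + J)) m1 (c1 : 'M_(m1, a)),
    (gdim F J.+1 <= \rank (evalmx F (c0 *m col_mx b w)))%N /\
    (gdim F a <= \rank (evalmx F (c1 *m (pid_mx a *m w))))%N.
Proof.
move=> le_aJ; have [m0 [c0 [u0 rk0]]] := gdim_attained F (1 + J)%N.
have [m1 [c1 [u1 rk1]]] := gdim_attained F a.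
rewrite -(vsubmxK u0) in rk0.
pose w1 : 'M[K]_(J, n) := pid_mx a *m u1.
pose W := mxpath (dsubmx u0) w1.
pose b := usubmx u0.
pose E := evalmx_poly F (map_mx polyC c0 *m col_mx (map_mx polyC b) W).
pose H := evalmx_poly F (map_mx polyC (c1 *m pid_mx a) *m W).
have EE t : mxeval t E = evalmx F (c0 *m col_mx b (mxeval t W)).
  by rewrite mxeval_evalmx mxevalM mxevalC mxeval_col_mx mxevalC.
have HE t : mxeval t H = evalmx F (c1 *m (pid_mx a *m mxeval t W)).
  by rewrite mxeval_evalmx mxevalM mxevalC mulmxA.
have [t [Et Ht]] := rank_mxeval_common E H 0 1.
exists b, (mxeval t W), m0, c0, m1, c1; rewrite -EE -HE.
rewrite -rk0 -rk1; split; [move: Et | move: Ht].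
  by rewrite [X in (\rank X <= _)%N -> _]EE mxpath0.
rewrite [X in (\rank X <= _)%N -> _]HE mxpath1 /w1 (mulmxA (pid_mx a)) mul_pid_mx.
by rewrite minnn (minn_idPr le_aJ) pid_mx_1 mul1mx.
Qed.

(* Let E be spanned by b and the rows of w, H the span of w, and x the linear
   relations on F(H). Points of E where the restriction of F to x has rank
   s + 1 lie in a subspace spanned by one of them, p, and s vectors z of H.
   Moving z inside H to a generic position keeps that rank, and makes
   F reach its maximal rank gdim a on the part of the subspace inside H. *)
Lemma gdim_step a J : (a <= J)%N ->
  (gdim F a + minn (gdim F J.+1 - gdim F J) a.+1 <= gdim F a.+1)%N.
Proof.
move=> le_aJ; have [b [w [m0 [c0 [m1 [c1 [rkE rkH]]]]]]] := gdim_flag le_aJ.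
have [m2 [y2 y2P]] := span_saturation (fun y : 'rV[K]_J => evalmx F (y *m w)).
pose c2 := \matrix_i y2 i.
have c2P : \matrix_i evalmx F (y2 i *m w) = evalmx F (c2 *m w).
  by apply/row_matrixP=> i; rewrite rowK -evalmx_row row_mul rowK.
rewrite c2P in y2P; pose x := cokermx (evalmx F (c2 *m w)).
have Hx m (y : 'M_(m, J)) : evalmx F (y *m w) *m x = 0.
  apply/row_matrixP=> i; rewrite row_mul row0 -evalmx_row row_mul.
  by apply/eqP; rewrite -sub_kermx (submx_trans (y2P _)) // sub_kermx mulmx_coker.
pose B := evalmx F (c0 *m col_mx b w) *m x.
have rkB : (gdim F J.+1 - gdim F J <= \rank B)%N.
  have le2 : (\rank (evalmx F (c2 *m w)) <= gdim F J)%N.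
    by rewrite gdim_max // (leq_trans (mxrankM_maxr _ _)) ?rank_leq_row.
  have := mxrank_mul_min (evalmx F (c0 *m col_mx b w)) x.
  rewrite mxrank_coker -/B; apply: leq_trans.
  have := rank_leq_col (evalmx F (c2 *m w)); lia.
case def_s : (minn _ a.+1) => [|s].
  by rewrite addn0 gdim_mono.
have /rank_row_selection [f] : (s.+1 <= \rank B)%N.
  by rewrite -def_s (leq_trans (geq_minl _ _)).
rewrite /B rowsubE mulmxA -rowsubE -evalmx_rowsub rowsubE mulmxA -rowsubE.
have {def_s} le_sa : (s <= a)%N by rewrite -ltnS -def_s geq_minr.
set C := rowsub f c0 => freeC.
pose lam := lsubmx C; pose y := rsubmx C.
have CE : C *m col_mx b w = lam *m b + y *m w by rewrite -[C]hsubmxK mul_row_col.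
have row0_lam : row 0 lam = (lam 0 0)%:M by rewrite (mx11_scalar (row 0 lam)) mxE.
(* If the first selected point had no component along [b], it would lie in H, where [x] kills F,
   against the independence [freeC]. *)
have lam_n0 : lam 0 0 != 0.
  apply/eqP => lam00.
  have : row 0 (evalmx F (C *m col_mx b w) *m x) = 0.
    rewrite row_mul -evalmx_row CE linearD /= !row_mul.
    rewrite (_ : row 0 lam = 0) ?mul0mx ?add0r ?Hx //.
    by rewrite row0_lam lam00 raddf0.
  rewrite rowE -[RHS](mul0mx _ (evalmx F (C *m col_mx b w) *m x)).
  move/(row_free_inj freeC)/matrixP/(_ 0 0); rewrite !mxE !eqxx => /eqP.
  by rewrite oner_eq0.
pose mu := (lam 0 0)^-1 *: lam; pose e : 'rV[K]_s.+1 := delta_mx 0 0.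
have e_mu : e *m mu = 1%:M.
  by rewrite -rowE linearZ /= row0_lam scale_scalar_mx mulVf.
pose p := e *m C *m col_mx b w.
pose z := (1%:M - mu *m e) *m y.
have Cp : C *m col_mx b w = mu *m p + z *m w.
  rewrite /p -[e *m C *m _]mulmxA CE /z !mulmxDr mulmxBl !mulmxBl !mul1mx.
  rewrite -!mulmxA -addrA [X in _ = _ + X]addrC subrK; congr (_ + _).
  by rewrite !mulmxA -(mulmxA mu) -rowE row0_lam mul_mx_scalar scalerA mulfV ?scale1r.
(* Since [e *m (1%:M - mu *m e) = 0], the factor [1%:M - mu *m e] has rank at most [s]. *)
have /rank_factor [D [Z zDZ]] : (\rank z <= a)%N.
  apply: leq_trans le_sa; apply: (leq_trans (mxrankM_maxl _ _)).
  have := @mulmx0_rank_max _ _ _ _ e (1%:M - mu *m e).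
  rewrite mulmxBr mulmx1 mulmxA e_mu mul1mx subrr => /(_ erefl).
  by rewrite mxrank_delta add1n ltnS.
(* At time 0 the points [P] attain [gdim F a]; at time 1 the points [Q] are the selected points of
   E. Both always lie in the span of [p] and the [a] rows of [V *m w]. *)
pose V := mxpath (pid_mx a) Z.
pose P := map_mx polyC c1 *m (V *m map_mx polyC w).
pose Q := map_mx polyC (mu *m p) + map_mx polyC D *m (V *m map_mx polyC w).
have PE t : mxeval t P = c1 *m (mxeval t V *m w) by rewrite !mxevalM !mxevalC.
have QE t : mxeval t Q = mu *m p + D *m (mxeval t V *m w).
  by rewrite mxevalD !mxevalM !mxevalC.
have [t [Pt Qt]] := rank_mxeval_common (evalmx_poly F P) (evalmx_poly F Q *m map_mx polyC x) 0 1.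
rewrite !mxevalM !mxevalC !mxeval_evalmx !PE !QE mxpath0 mxpath1 in Pt Qt.
rewrite (mulmxA D) -zDZ -Cp (eqP freeC) in Qt.
apply: (@leq_trans (\rank (evalmx F (col_mx (mxeval t P) (mxeval t Q))))).
  rewrite evalmx_col_mx (leq_trans _ (rank_col_mx_ann _ _ (x := x))) //.
    by rewrite QE PE leq_add // (leq_trans rkH).
  by rewrite PE mulmxA Hx.
apply: gdim_max.
have -> : col_mx (mxeval t P) (mxeval t Q) =
    block_mx 0 c1 mu D *m col_mx p (mxeval t V *m w).
  by rewrite mul_block_col mul0mx add0r PE QE.
by rewrite (leq_trans (mxrankM_maxr _ _)) // (leq_trans (rank_leq_row _)).
Qed.

End Growth.

(** * Dimensions of images of orthogonal subspaces *)

Section Orthogonality.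
Variables (K : numFieldType) (n r : nat) (F G : 'I_r -> {mpoly K[n]}).
Variable M : 'M[K]_n.
Hypothesis FG_orth : forall z w : 'rV_n,
  z *m M *m w^T = 0 -> evalmx F z *m (evalmx G w)^T = 0.

Lemma evalmx_orth m1 m2 (P : 'M_(m1, n)) (Q : 'M_(m2, n)) :
  P *m M *m Q^T = 0 -> evalmx F P *m (evalmx G Q)^T = 0.
Proof.
move=> PMQ0; apply/matrixP=> i k.
have /FG_orth/matrixP/(_ 0 0) : row i P *m M *m (row k Q)^T = 0.
  by rewrite -row_mul tr_row colE mulmxA -row_mul PMQ0 row0 mul0mx.
by rewrite !evalmx_row tr_row colE mulmxA -row_mul -colE !mxE.
Qed.

(* W is, up to the factor det S, the projection of v0^T along the columns of y
   onto the right orthogonal of the rows of U; it is v0^T at t = 1, so along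
   the path both u0 and v0 are approached by mutually orthogonal pairs. *)
Lemma gdim_orth j a : (j + a <= \rank M)%N -> (gdim F j + gdim G a <= r)%N.
Proof.
move=> le_ja; have [m0 [c0 [u0 <-]]] := gdim_attained F j.
have [m1 [c1 [v0 <-]]] := gdim_attained G a.
pose B := M *m v0^T.
(* The left orthogonal of [v0] has dimension at least [n - a], and multiplying by [M] loses at most
   [n - \rank M], so rank [j] remains. *)
have [c [y]] : exists (c : 'M_(j, n)) (y : 'M_(n, j)), c *m (kermx B *m M) *m y = 1%:M.
  apply: rank_minor; have := mxrank_mul_min (kermx B) M; rewrite mxrank_ker.
  have := rank_leq_col B; have := rank_leq_row B; have := rank_leq_row M; lia.
rewrite mulmxA; set u1 := c *m kermx B => u1My.
have u1Mv0 : u1 *m M *m v0^T = 0 by rewrite -mulmxA -/B /u1 -mulmxA mulmx_ker mulmx0.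
pose U := mxpath u0 u1.
pose S t := mxeval t U *m M *m y.
pose Sx := U *m map_mx polyC M *m map_mx polyC y.
have SE t : mxeval t Sx = S t by rewrite !mxevalM !mxevalC.
pose W := \det Sx *: map_mx polyC v0^T
  - map_mx polyC y *m \adj Sx *m (U *m map_mx polyC M *m map_mx polyC v0^T).
pose w t := \det (S t) *: v0^T - y *m \adj (S t) *m (mxeval t U *m M *m v0^T).
have WE t : mxeval t W = w t.
  rewrite /W mxevalD [mxeval t (- _)]map_mxN [mxeval t (_ *: _)]map_mxZ.
  rewrite -[map_mx _ (map_mx _ _)]/(mxeval t _) -[map_mx _ (_ *m _)]/(mxeval t _).
  rewrite !mxevalM !mxevalC [mxeval t (\adj _)]map_mx_adj -det_map_mx.
  by rewrite -/(mxeval t Sx) SE.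
have orth t : (c0 *m mxeval t U) *m M *m (c1 *m (w t)^T)^T = 0.
  rewrite trmx_mul trmxK -!(mulmxA c0) (mulmxA _ (w t)).
  suff -> : mxeval t U *m M *m w t = 0 by rewrite mul0mx mulmx0.
  rewrite mulmxBr -scalemxAr !mulmxA -/(S t) mul_mx_adj !mul_scalar_mx.
  by rewrite -!scalemxAl subrr.
have [t] := rank_mxeval_common (evalmx_poly F (map_mx polyC c0 *m U))
  (evalmx_poly G (map_mx polyC c1 *m W^T)) 0 1.
have trE s : mxeval s W^T = (w s)^T by rewrite -WE [RHS]map_trmx.
rewrite !mxeval_evalmx !mxevalM !mxevalC !trE mxpath0.
have -> : w 1 = v0^T.
  by rewrite /w /S !mxpath1 u1My u1Mv0 mulmx0 subr0 det1 scale1r.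
rewrite trmxK => -[rkF rkG]; apply: (leq_trans (leq_add rkF rkG)).
by rewrite -(mxrank_tr (evalmx G _)) mulmx0_rank_max // evalmx_orth.
Qed.

End Orthogonality.

(** * Polynomials determined by their values *)

Lemma digits_inj n N (a b : 'I_n -> nat) :
    (forall i, a i < N)%N -> (forall i, b i < N)%N ->
  (\sum_i a i * N ^ i = \sum_i b i * N ^ i)%N -> a =1 b.
Proof.
elim: n a b => [|n IHn] a b ltaN ltbN; first by move=> _ [].
have N_gt0 : (0 < N)%N by apply: leq_ltn_trans (ltaN ord0).
have shiftE (c : 'I_n.+1 -> nat) :
    (\sum_i c i * N ^ i = (\sum_(i < n) c (lift ord0 i) * N ^ i) * N + c ord0)%N.
  rewrite big_ord_recl muln1 addnC big_distrl /=; congr (_ + _)%N.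
  by apply: eq_bigr => i _; rewrite /bump add1n expnSr mulnA.
rewrite !shiftE => eq_ab.
have eq0 : a ord0 = b ord0.
  by have /(congr1 (modn^~ N)) := eq_ab; rewrite !modnMDl !modn_small.
have /(congr1 (divn^~ N)) := eq_ab; rewrite !divnMDl // !divn_small // !addn0.
move=> /IHn eqS i; case: (unliftP ord0 i) => [k|] -> //.
by apply: eqS => l.
Qed.

Section Vanishing.
Variable K : numFieldType.

(* Kronecker substitution X_i |-> X^(N^i) with N beyond all exponents of p. *)
Lemma mpoly_vanish n (p : {mpoly K[n]}) : (forall v, p.@[v] = 0) -> p = 0.
Proof.
move=> p0; pose N := msize p; pose e (m : 'X_{1..n}) := (\sum_i m i * N ^ i)%N.
pose q : {poly K} := \sum_(m <- msupp p) p@_m *: 'X^(e m).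
have q0 : q = 0.
  apply: poly_vanish => k; rewrite -(p0 (fun i => k%:R ^+ (N ^ i))) mevalE.
  rewrite /q horner_sum; apply: eq_bigr => m _.
  rewrite hornerZ hornerXn; congr (_ * _); rewrite /e expr_sum.
  by apply: eq_bigr => i _; rewrite mulnC exprM.
have ltN m i : m \in msupp p -> (m i < N)%N.
  by move=> /msize_mdeg_lt; apply: leq_ltn_trans; rewrite mdegE (bigD1 i) //= leq_addr.
apply/mpolyP=> m; rewrite mcoeff0; case: (boolP (m \in msupp p)) => [pm|]; last first.
  by move=> /memN_msupp_eq0.
have := congr1 (fun s : {poly K} => s`_(e m)) q0; rewrite coef0 coef_sum.
rewrite (bigD1_seq m) ?msupp_uniq //= coefZ coefXn eqxx mulr1 big_seq_cond big1 ?addr0 //.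
move=> m' /andP[pm' ne_m]; rewrite coefZ coefXn; case: eqP => [eq_e|]; last by rewrite mulr0.
case/eqP: ne_m; apply/mnmP => i; apply: (@digits_inj n N m' m) => // k; exact: ltN.
Qed.

(** A cokernel column of F on a saturating set of points is a linear relation among the values of F
    everywhere, hence among the polynomials, hence trivial. *)
Lemma gdim_full n r (F : 'I_r -> {mpoly K[n]}) :
  (forall c : 'I_r -> K, \sum_s c s *: F s = 0 -> forall s, c s = 0) ->
  gdim F n = r.
Proof.
move=> indF; apply/eqP; rewrite eqn_leq gdim_le.
have [m [p satp]] := span_saturation (fun z : 'rV[K]_n => evalmx F z).
have pE : \matrix_i evalmx F (p i) = evalmx F (\matrix_i p i).
  by apply/row_matrixP => i; rewrite rowK -evalmx_row rowK.
rewrite {}pE in satp; set A := evalmx F _ in satp.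
suff /eqP cok0 : cokermx A == 0.
  have := gdim_max F (rank_leq_col (\matrix_i p i)); rewrite -/A.
  have /eqP -> // : row_full A by rewrite -cokermx_eq0 cok0.
apply/eqP/matrixP => s k; rewrite [RHS]mxE.
apply: (indF (fun s => cokermx A s k)); apply: mpoly_vanish => v.
have := satp (\row_j v j); rewrite submxE => /eqP /matrixP /(_ 0 k) vanish_k.
rewrite mxE [RHS]mxE in vanish_k; rewrite raddf_sum /= -[RHS]vanish_k; apply: eq_bigr => l _.
by rewrite mevalZ mulrC [evalmx _ _ _ _]mxE; congr (_ * _); apply: meval_eq => j; rewrite mxE.
Qed.

End Vanishing.

(** * Arithmetic of the dimension sequence *)

Section Arithmetic.
Variables (d : nat -> nat) (n nu r k : nat).
Local Open Scope nat_scope.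

Hypothesis d_step : forall a J, a <= J -> d a + minn (d J.+1 - d J) a.+1 <= d a.+1.
Hypothesis d_orth : forall j, j <= nu -> d j + d (nu - j) <= r.
Hypothesis d_top : d n = r.
Hypothesis d_le : forall a, d a <= r.
Hypothesis nu_le : nu <= n.
Hypothesis r_lt : r + k * k.+1 < k.+1 * nu.

(** The increments up to [a] are at least 1, 2, ..., k + 1, then k + 1 each; the sum is doubled to
    avoid halves. *)
Lemma growth_lower J a : k < d J.+1 - d J -> a <= J.+1 ->
  2 * (k.+1 * a) <= 2 * d a + k * k.+1.
Proof.
move=> big_J; have low b : b <= k.+1 -> b <= J.+1 -> b * b.+1 <= 2 * d b.
  elim: b => [|b IHb] // ltbk ltbJ; have := d_step (ltbJ : b <= J).
  have := IHb (ltnW ltbk) (ltnW ltbJ); have : b.+1 <= minn (d J.+1 - d J) b.+1 by lia.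
  nia.
have [le_ak le_aJ|/ltnW/subnKC <-] := leqP a k.+1.
  have := low a le_ak le_aJ.
  (* From [a * a.+1 <= 2 * d a] the claim reduces to (k - a)(k - a + 1) >= 0. *)
  have [lt_ak|->] : a < k.+1 \/ a = k.+1 by lia.
    have [c ->] : exists c, k = a + c by exists (k - a); lia.
    by nia.
  by nia.
elim: (a - k.+1) => [|b IHb] le_bJ.
  by rewrite addn0 in le_bJ *; have := low k.+1 (leqnn _) le_bJ; nia.
rewrite addnS in le_bJ *; have := IHb (ltnW le_bJ); have := d_step (le_bJ : k.+1 + b <= J).
have : k.+1 <= minn (d J.+1 - d J) (k.+1 + b).+1 by lia.
nia.
Qed.

(** A larger increment makes [growth_lower] at [J.+1] and [nu - J.+1] contradict [d_orth]; when
    [J.+1 > nu], the bound at [J.+1] alone exceeds [r]. *)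
Lemma increment_bound J : nu <= 2 * J.+1 -> d J.+1 - d J <= k.
Proof.
move=> nuJ; rewrite leqNgt; apply/negP => big_J.
have low_J := growth_lower big_J (leqnn _); have le_dr := d_le J.+1.
have [le_Jnu|lt_nuJ] := leqP J.+1 nu; last by nia.
have low_nuJ := @growth_lower J (nu - J.+1) big_J ltac:(lia).
have := d_orth le_Jnu; nia.
Qed.

Lemma increments_sum a b : a <= b -> nu <= 2 * a.+1 -> d b <= d a + k * (b - a).
Proof.
move=> /subnKC <-; rewrite addKn => nua; elim: (b - a) => [|c IHc]; first by rewrite addn0 leq_addr.
have := @increment_bound (a + c) ltac:(lia); rewrite addnS; nia.
Qed.

(** Climbing to [n] from [h] and from [nu - h] and adding gives 2r <= d_h + d_(nu - h) + k(2n - nu),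
    where the two dimensions sum to at most r. *)
Lemma top_bound : r <= k * (n + (n - nu)).
Proof.
pose h := nu./2; have hE : nu <= 2 * h.+1 /\ 2 * h <= nu by rewrite /h; lia.
have := @increments_sum h n ltac:(lia) ltac:(lia).
have := @increments_sum (nu - h) n ltac:(lia) ltac:(lia).
have := @d_orth h ltac:(lia); rewrite d_top; nia.
Qed.

End Arithmetic.

(** * Corank and the zero eigenvalue *)

(** Row reduction [C] makes the last [n - \rank M] rows of [C *m M] vanish, so those rows of [C]
    times the characteristic matrix are divisible by ['X]. *)
Lemma corank_le_mup0 (K : fieldType) n (M : 'M[K]_n) :
  (n - \rank M <= mup 0 (char_poly M))%N.
Proof.
have [C unitC CM] : exists2 C, C \in unitmx & C *m M = pid_mx (\rank M) *m row_ebase M.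
  exists (invmx (col_ebase M)); first by rewrite unitmx_inv col_ebase_unit.
  by rewrite -{2}(mulmx_ebase M) -mulmxA mulKmx // col_ebase_unit.
rewrite mup_geq ?monic_neq0 ?char_poly_monic // subr0.
pose c := \det C; have c_n0 : c != 0 by rewrite -unitfE -unitmxE.
rewrite -(dvdpZr _ _ c_n0) -mul_polyC -det_map_mx -det_mulmx.
pose D : 'rV[{poly K}]_n := \row_i (if (i < \rank M)%N then 1 else 'X).
pose N := \matrix_(i, j) (if (i < \rank M)%N
  then (map_mx polyC C *m char_poly_mx M) i j else (C i j)%:P).
have -> : map_mx polyC C *m char_poly_mx M = diag_mx D *m N.
  apply/matrixP => i j; rewrite mul_diag_mx [RHS]mxE [D _ _]mxE [N _ _]mxE.
  case: ltnP => [|le_ri]; first by rewrite mul1r.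
  rewrite mulmxBr -map_mxM CM mul_mx_scalar !mxE big1 ?subr0 ?mul0r // => k _.
  by rewrite !mxE ltnNge le_ri andbF mul0r.
rewrite det_mulmx dvdp_mulr // det_diag.
rewrite (eq_bigr (fun i : 'I_n => if (i < \rank M)%N then 1 else 'X)); last first.
  by move=> i _; rewrite mxE.
rewrite -(big_mkord xpredT (fun i => if (i < \rank M)%N then 1 else 'X)).
rewrite (big_cat_nat (leq0n _) (rank_leq_row M)) /= dvdp_mull //.
rewrite big_nat (eq_bigr (fun=> 'X)) -?big_nat ?prodr_const_nat //.
by move=> i /andP[le_ri _]; rewrite ltnNge le_ri.
Qed.

(** * Polarization of Hermitian polynomials *)

Lemma meval_map_mpoly (K : comNzRingType) n (f : {rmorphism K -> K})
    (p : {mpoly K[n]}) v : (map_mpoly f p).@[f \o v] = f p.@[v].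
Proof.
rewrite [in RHS]mevalE /map_mpoly /mmap !raddf_sum; apply: eq_bigr => m _ /=.
rewrite mevalM mevalC mmap1_id mevalX rmorphM rmorph_prod.
by congr (_ * _); apply: eq_bigr => i _; rewrite rmorphXn.
Qed.

(** Conjugating the second equation gives [u - v * 'i = b^*], a linear system together with the
    first. *)
Lemma conj_pair (K : numClosedFieldType) (a b : K) :
  let u := (a + b^* ) / 2 in let v := - 'i * ((a - b^* ) / 2) in
  u + v * 'i = a /\ u^* + v^* * 'i = b.
Proof.
move=> u v; have half x y : (x + y) / 2 + (x - y) / 2 = x :> K.
  by rewrite -mulrDl addrACA subrr addr0 mulrDl -splitr.
have conj2 : 2^-1^* = 2^-1 :> K by rewrite fmorphV rmorph_nat.
have vi : v * 'i = (a - b^* ) / 2 by rewrite mulrAC mulNr mulCii opprK mul1r.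
have vci : v^* * 'i = (b - a^* ) / 2.
  rewrite rmorphM rmorphN /= conjCi opprK mulrAC mulCii mulN1r.
  by rewrite rmorphM rmorphB /= conjCK conj2 -mulNr opprB.
by rewrite vi vci rmorphM rmorphD /= conjCK conj2 [a^* + b]addrC !half.
Qed.

Section Polarization.
Variables (R : realType) (n : nat).
Local Notation C := R[i].

(* On the real line s |-> u + s v the conjugate is the polynomial u^* + s v^*,
   and at s = 'i the pair (u + s v, u^* + s v^* ) is arbitrary. *)
Lemma evalzzbar_vanish (Q : {mpoly C[n + n]}) :
  (forall z, evalzzbar Q z = 0) -> Q = 0.
Proof.
move=> Q0; apply: mpoly_vanish => x.
pose a j := x (lshift n j); pose b j := x (rshift n j).
have [u uP] : exists u : 'I_n -> C * C, forall j,
    (u j).1 + (u j).2 * 'i = a j /\ (u j).1^* + (u j).2^* * 'i = b j.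
  exists (fun j => ((a j + (b j)^* ) / 2, - 'i * ((a j - (b j)^* ) / 2))) => j.
  exact: conj_pair.
pose h i : {poly C} := match split i with
  | inl j => (u j).1%:P + (u j).2 *: 'X
  | inr j => ((u j).1^* )%:P + ((u j).2^* ) *: 'X end.
have hq : mmap polyC h Q = 0.
  apply: poly_vanish => k; rewrite horner_mmap -(Q0 (fun j => (u j).1 + (u j).2 * k%:R)).
  apply: meval_eq => i; rewrite /h /zzbar; case: split => j.
    by rewrite hornerD hornerC hornerZ hornerX.
  by rewrite hornerD hornerC hornerZ hornerX rmorphD rmorphM /= rmorph_nat.
have := horner_mmap h Q 'i; rewrite hq horner0 => ->; apply: meval_eq => i.
rewrite /h; case: splitP => j def_i; rewrite hornerD hornerC hornerZ hornerX.
  have -> : i = lshift n j by apply: val_inj.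
  by have [] := uP j.
have -> : i = rshift n j by apply: val_inj.
by have [] := uP j.
Qed.

Definition in_z (p : {mpoly C[n]}) : {mpoly C[n + n]} :=
  p \mPo [tuple zvar R i | i < n].

Definition in_zbar (p : {mpoly C[n]}) : {mpoly C[n + n]} :=
  p \mPo [tuple zbarvar R i | i < n].

Lemma meval_in_z_zbar p q x : (in_z p * in_zbar q).@[x] =
  p.@[fun j => x (lshift n j)] * q.@[fun j => x (rshift n j)].
Proof.
rewrite mevalM; congr (_ * _); apply: etrans (comp_mpoly_meval _ _ _) _.
  by apply: meval_eq => j; rewrite tnth_mktuple mevalXU.
by apply: meval_eq => j; rewrite tnth_mktuple mevalXU.
Qed.

Lemma sqnorm_polyE (h : {hermitian_sym 'rV[C]_n for Num.conj}) (z w : 'rV[C]_n) :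
  (sqnorm_poly h).@[row_mx z w 0] = (z *m matrix_of_form h *m w^T) 0 0.
Proof.
rewrite /sqnorm_poly raddf_sum [RHS]mxE.
under [RHS]eq_bigr do rewrite mxE big_distrl /=.
rewrite exchange_big; apply: eq_bigr => i _; rewrite raddf_sum; apply: eq_bigr => j _.
rewrite /= mevalZ mevalM !mevalXU row_mxEl row_mxEr [w^T _ _]mxE.
by rewrite mulrCA mulrA.
Qed.

End Polarization.

(** * Hermitian rank and the map F *)

Section HermitianRank.
Variables (R : realType) (n : nat).
Local Notation C := R[i].

(** Only coefficients are conjugated, so the result is polynomial in a free variable w and equals
    e_s times the conjugate of F_s(z) at w = zbar. *)
Definition conj_family r (e : 'I_r -> C) (F : 'I_r -> {mpoly C[n]}) s :=
  e s *: map_mpoly Num.conj (F s).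

(** Conjugation is a field automorphism and scaling by the nonzero [e s] is invertible; both
    preserve rank. *)
Lemma gdim_conj_family r (e : 'I_r -> C) (F : 'I_r -> {mpoly C[n]}) a :
  (forall s, e s != 0) -> (gdim F a <= gdim (conj_family e F) a)%N.
Proof.
move=> e_n0; have [m [c [u <-]]] := gdim_attained F a.
have -> : \rank (evalmx F (c *m u)) =
    \rank (evalmx (conj_family e F) (map_mx Num.conj (c *m u))).
  have -> : evalmx (conj_family e F) (map_mx Num.conj (c *m u)) =
      map_mx Num.conj (evalmx F (c *m u)) *m diag_mx (\row_s e s).
    apply/matrixP => i s; rewrite mul_mx_diag !mxE mevalZ mulrC -meval_map_mpoly.
    by congr (_ * _); apply: meval_eq => j /=; rewrite mxE.
  rewrite mxrankMfree ?mxrank_map // row_free_unit unitmxE det_diag unitfE.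
  by apply/prodf_neq0 => s _; rewrite mxE.
by rewrite gdim_max // mxrank_map (leq_trans (mxrankM_maxr _ _)) ?rank_leq_row.
Qed.

(** The sum of signed squares agrees with [P] on conjugate pairs, and [evalzzbar_vanish] makes this
    an identity in independent variables. *)
Lemma hermitian_rank_decomposition (P : {mpoly C[n + n]}) r :
  hermitian_rank P r -> exists (e : 'I_r -> C) (F : 'I_r -> {mpoly C[n]}),
    [/\ forall c : 'I_r -> C, \sum_s c s *: F s = 0 -> forall s, c s = 0,
        forall s, e s != 0
      & P = \sum_s in_z (F s) * in_zbar (conj_family e F s)].
Proof.
move=> [p [q [Pp [Pm [ind PE ->]]]]].
exists (fun s => if split s then 1 else -1).
exists (fun s => match split s with inl i => Pp i | inr j => Pm j end).
have splitl i : split (lshift q i) = inl i :> 'I_p + 'I_q by exact: (unsplitK (inl i)).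
have splitr j : split (rshift p j) = inr j :> 'I_p + 'I_q by exact: (unsplitK (inr j)).
split=> [c c0 s|s|].
- rewrite -(splitK s); apply: (ind (fun t => c (unsplit t))).
  rewrite -[RHS]c0 big_split_ord big_sumType /=.
  by congr (_ + _); apply: eq_bigr => i _; rewrite ?splitl ?splitr.
- by case: split => ? /=; rewrite ?oppr_eq0 oner_eq0.
apply: subr0_eq; apply: evalzzbar_vanish => z.
rewrite /evalzzbar mevalB -/(evalzzbar P z) PE -sumrN big_split_ord mevalD.
rewrite ![(\sum_i _).@[_]]raddf_sum /=.
have termE (f : {mpoly C[n]}) (a : C) :
    (in_z f * in_zbar (a *: map_mpoly Num.conj f)).@[zzbar z] = a * `|f.@[z]| ^+ 2.
  rewrite meval_in_z_zbar mevalZ normCK mulrCA; congr (_ * (_ * _)).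
    by apply: meval_eq => j; rewrite /zzbar (unsplitK (inl j)).
  rewrite -meval_map_mpoly; apply: meval_eq => j.
  by rewrite /zzbar (unsplitK (inr j)).
apply/eqP; rewrite subr_eq0; apply/eqP; congr (_ + _); apply: eq_bigr => i _.
  by rewrite /conj_family splitl termE mul1r.
by rewrite /conj_family splitr termE mulN1r.
Qed.

Variables (h : {hermitian_sym 'rV[C]_n for Num.conj}) (A : {mpoly C[n + n]}).

(** Here [w] takes the place of zbar, so the form is bilinear in [z] and [w] and [w^T] carries no
    conjugate. *)
Lemma sqnorm_factor_orth r (F G : 'I_r -> {mpoly C[n]}) (z w : 'rV[C]_n) :
    A * sqnorm_poly h = \sum_s in_z (F s) * in_zbar (G s) ->
  z *m matrix_of_form h *m w^T = 0 -> evalmx F z *m (evalmx G w)^T = 0.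
Proof.
move=> /(congr1 (meval (row_mx z w 0))).
rewrite mevalM sqnorm_polyE raddf_sum /= => FG zw0.
apply/rowP=> i; rewrite ord1 [RHS]mxE; move: FG; rewrite zw0 [_ 0 0]mxE mulr0 => ->.
rewrite mxE; apply: eq_bigr => s _; rewrite meval_in_z_zbar !mxE.
by congr (_ * _); apply: meval_eq => j; rewrite (row_mxEl, row_mxEr).
Qed.

Lemma sqnorm_poly_neq0 : matrix_of_form h != 0 -> sqnorm_poly h != 0.
Proof.
apply: contra_neq => h0; apply/matrixP => i j; rewrite [RHS]mxE.
have := sqnorm_polyE h (delta_mx 0 i) (delta_mx 0 j).
by rewrite h0 meval0 -rowE trmx_delta -colE mxE [row _ _ _ _]mxE.
Qed.

Lemma hermitian_rank_gap r k :
    A != 0 -> (nullity h < n)%N -> hermitian_rank (A * sqnorm_poly h) r ->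
    (r + k * k.+1 < k.+1 * (n - nullity h))%N ->
  (0 < r <= k * (n + nullity h))%N.
Proof.
move=> A_n0 null_lt /hermitian_rank_decomposition [e [F [indF e_n0 AhE]]] r_lt.
have rank_h := corank_le_mup0 (matrix_of_form h); rewrite -/(nullity h) in rank_h.
have orth z w := @sqnorm_factor_orth r F (conj_family e F) z w AhE.
apply/andP; split.
  rewrite lt0n; apply/eqP => r0; move: e F AhE {indF e_n0 orth}; rewrite r0 => e F.
  rewrite big_ord0 => /eqP; rewrite mulf_eq0 (negPf A_n0); apply/negP.
  apply: sqnorm_poly_neq0; rewrite -mxrank_eq0; lia.
have -> : nullity h = (n - (n - nullity h))%N by lia.
apply: (@top_bound (gdim F)) r_lt.
- by move=> a J; apply: gdim_step.
- move=> j le_j.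
  apply: leq_trans (gdim_orth orth (j := j) (a := n - nullity h - j) _); last first.
    by rewrite subnKC // leq_subLR addnC -leq_subLR.
  by rewrite leq_add2l gdim_conj_family.
- exact: gdim_full.
- exact: gdim_le.
- exact: leq_subr.
Qed.

End HermitianRank.

(** * Gaps between the possible ranks *)

Theorem theorem1p2 (R : realType) (n : nat)
    (h : {hermitian_sym 'rV[R[i]]_n for Num.conj})
    (tau k0 : nat) (A : {mpoly R[i][n + n]}) (r : nat)
    (hn : (1 <= n)%N)
    (htau : tau = nullity h)
    (htau2 : (tau + 2 <= n)%N)
    (hk0 : is_largest
      (fun k => (k ^ 2 + k * (3 + 2 * tau) + 2 + tau <= n)%N) k0)
    (hA0 : A != 0)
    (hA : hermitian_poly A)
    (hr : hermitian_rank (A * sqnorm_poly h) r) :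
  (k0%:Z + 1) * n%:Z - (k0%:Z + 1) * (k0%:Z + tau%:Z) <= r%:Z \/
  exists k : nat, (1 <= k <= k0)%N /\
    k%:Z * n%:Z - k%:Z * (k%:Z - 1 + tau%:Z) <= r%:Z
      <= k%:Z * n%:Z + k%:Z * (2 + tau%:Z).
Proof.
(* This is r < (k + 1)(n - tau - k) with [k] moved across; its failure at [k0] is the first
   alternative. *)
pose below k := (r + k * k.+1 < k.+1 * (n - tau))%N.
have [below_k0|/negP] := boolP (below k0); last by rewrite /below; left; nia.
have [k below_k min_k] := ex_minnP (ex_intro below k0 below_k0).
have /andP[r_gt0 r_le] : (0 < r <= k * (n + tau))%N.
  have := hermitian_rank_gap (k := k) hA0 _ hr; rewrite -htau => -> //; lia.
have k_gt0 : (0 < k)%N by lia.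
right; exists k; rewrite k_gt0 min_k //; split=> //.
(* Failure at k - 1 reads r >= k(n - tau - k + 1), the lower bound sought. *)
have : ~~ below k.-1 by apply/negP => /min_k; lia.
by rewrite /below; case: k {below_k min_k k_gt0} r_le => [|k] /=; nia.
Qed.
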